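(* Let $R_1=\{(a,b): a,b\in\{0,1,2\}\}$ and $R_2=\{(a,b): a,b\in\{1,2,3\}\}$. Then the mesh patterns $(123,R_1)$ and $(321,R_1)$ are jointly equidistributed, and the mesh patterns $(123,R_2)$ and $(321,R_2)$ are jointly equidistributed.
   Context: $S_n$ is the set of permutations of $\{1,\dots,n\}$. A mesh pattern of length $k$ is a pair $(\tau,R)$ with $\tau\in S_k$ and $R\subseteq\{0,\dots,k\}^2$; the element $(a,b)\in R$ is the ''shaded box'' whose corners are $(a,b),(a,b+1),(a+1,b+1),(a+1,b)$ in the plot of $\tau$ (first coordinate = position, second = value). An occurrence of $(\tau,R)$ in $\pi=\pi_1\cdots\pi_n\in S_n$ is a tuple of indices $i_1<\dots<i_k$ such that $\pi_{i_1}\cdots\pi_{i_k}$ is order-isomorphic to $\tau$ and, setting $i_0=0$, $i_{k+1}=n+1$, letting $v_1<\dots<v_k$ be the values $\pi_{i_1},\dots,\pi_{i_k}$ in increasing order and $v_0=0$, $v_{k+1}=n+1$, for every $(a,b)\in R$ there is no index $m$ with $i_a<m<i_{a+1}$ and $v_b<\pi_m<v_{b+1}$. The number of occurrences is the number of such index tuples. Two mesh patterns $q_1,q_2$ are jointly equidistributed if for all $n\ge 1$ and all integers $k,\ell\ge 0$, the number of $\pi\in S_n$ with exactly $k$ occurrences of $q_1$ and exactly $\ell$ occurrences of $q_2$ equals the number of $\pi\in S_n$ with exactly $\ell$ occurrences of $q_1$ and exactly $k$ occurrences of $q_2$. *)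

(* Defs.v *)
From mathcomp Require Import all_boot all_fingroup.

Set Implicit Arguments.
Unset Strict Implicit.
Unset Printing Implicit Defensive.

(* Permutations of {1, .., n} are elements of 'S_n, i.e., permutations of
   'I_n = {0, .., n-1}; the mathematical position (resp. value) attached to
   x : 'I_n is x.+1, so that 0 and n.+1 are available as sentinels for the
   boundary grid lines. *)

Record mesh_pattern (k : nat) := MeshPattern {
  underlying : 'S_k;
  shading : {set 'I_k.+1 * 'I_k.+1}
}.

Section Occurrences.

Variables (n k : nat) (pi : 'S_n).
Implicit Types (t : k.-tuple 'I_n) (q : mesh_pattern k).

(* [:: i_0; i_1; ...; i_k; i_(k+1)] with i_0 = 0 and i_(k+1) = n + 1 *)
Definition position_lines t : seq nat :=
  0 :: rcons [seq (nat_of_ord i).+1 | i <- t] n.+1.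

(* [:: v_0; v_1; ...; v_k; v_(k+1)] with v_0 = 0 and v_(k+1) = n + 1 *)
Definition value_lines t : seq nat :=
  0 :: rcons (sort leq [seq (nat_of_ord (pi i)).+1 | i <- t]) n.+1.

Definition in_box t (c : 'I_k.+1 * 'I_k.+1) (m : 'I_n) : bool :=
  let x := nth 0 (position_lines t) in
  let y := nth 0 (value_lines t) in
  (x c.1 < m.+1 < x c.1.+1) && (y c.2 < (pi m).+1 < y c.2.+1).

Definition order_isomorphic t (tau : 'S_k) : bool :=
  [forall a, forall b, (pi (tnth t a) < pi (tnth t b)) == (tau a < tau b)].

Definition is_occurrence q t : bool :=
  [&& sorted ltn [seq nat_of_ord i | i <- t],
      order_isomorphic t (underlying q)
    & [forall c in shading q, ~~ [exists m, in_box t c m]]].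

Definition occurrences q : nat := #|[set t | is_occurrence q t]|.

End Occurrences.

Definition jointly_equidistributed (k1 k2 : nat)
    (q1 : mesh_pattern k1) (q2 : mesh_pattern k2) : Prop :=
  forall n k l : nat, 1 <= n ->
    #|[set pi : 'S_n | (occurrences pi q1 == k) && (occurrences pi q2 == l)]| =
    #|[set pi : 'S_n | (occurrences pi q1 == l) && (occurrences pi q2 == k)]|.

Definition perm123 : 'S_3 := 1%g.
Definition perm321 : 'S_3 := perm (@rev_ord_inj 3).

Definition R1 : {set 'I_4 * 'I_4} :=
  [set c | (nat_of_ord c.1 \in [:: 0; 1; 2]) && (nat_of_ord c.2 \in [:: 0; 1; 2])].
Definition R2 : {set 'I_4 * 'I_4} :=
  [set c | (nat_of_ord c.1 \in [:: 1; 2; 3]) && (nat_of_ord c.2 \in [:: 1; 2; 3])].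

(* Main.v *)
Require Import Defs.
From mathcomp Require Import all_boot all_fingroup.
From mathcomp Require Import zify.

(* The boxes of R1 contain everything below and to the left of the pattern's
   bounding box, so an occurrence of (tau, R1) ending at position p says
   that the three smallest values of the prefix of length p form the pattern
   tau, and that pi_p is among them.  Build pi by appending last entries of
   relative rank r (from 0), and remember whether the two smallest values so
   far are ascending.  For r >= 3 nothing changes; otherwise
     - an ascending state creates a 123 if r = 2, a descending one a 321 if
       r = 0, and no other occurrence arises;
     - the new state is descending if r = 0, ascending if r = 1, and unchanged
       if r = 2.
   Exchanging the two states while permuting r along 0 -> 1 -> 2 -> 0
   (from ascending) or its inverse (from descending) preserves these rules and
   exchanges 123 with 321.  The shading R2 is the reverse-complement of R1. *)

Set Implicit Arguments.
Unset Strict Implicit.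
Unset Printing Implicit Defensive.

(** * Mesh conditions restated without boxes *)

Lemma exists_ord4 (P : pred nat) :
  [exists a : 'I_4, P a] = [|| P 0, P 1, P 2 | P 3].
Proof.
apply/existsP/idP => [[[[|[|[|[|//]]]] ?] /= ->]|]; rewrite ?orbT //.
by case/or4P => Pa; [exists (@Ordinal 4 0 isT) | exists (@Ordinal 4 1 isT)
  | exists (@Ordinal 4 2 isT) | exists (@Ordinal 4 3 isT)].
Qed.

(** Strips 0, 1, 2 fill the range from 0 up to the largest element of [s], missing only the grid
    lines themselves. The sentinel [N] bounds none of them. *)
Lemma lower_strips (s : seq nat) N y :
  size s = 3 -> sorted leq s -> 0 < y ->
  [exists a : 'I_4, ((a : nat) \in [:: 0; 1; 2]) &&
     (nth 0 (0 :: rcons s N) a < y < nth 0 (0 :: rcons s N) a.+1)] =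
  (y \notin s) && has (fun x => y < x) s.
Proof.
case: s => [|p [|q [|r [|//]]]] //= _ /and3P[pq qr _] y_gt0.
rewrite (exists_ord4 (fun a => (a \in _) && (nth 0 [:: 0; p; q; r; N] a < y <
  nth 0 [:: 0; p; q; r; N] a.+1))) /= !inE.
lia.
Qed.

(** Mirror image of [lower_strips]: strip 3 now ends at the sentinel [N], and the sentinel 0 bounds
    none of the strips. *)
Lemma upper_strips (s : seq nat) N y :
  size s = 3 -> sorted leq s -> y < N ->
  [exists a : 'I_4, ((a : nat) \in [:: 1; 2; 3]) &&
     (nth 0 (0 :: rcons s N) a < y < nth 0 (0 :: rcons s N) a.+1)] =
  (y \notin s) && has (fun x => x < y) s.
Proof.
case: s => [|p [|q [|r [|//]]]] //= _ /and3P[pq qr _] y_ltN.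
rewrite (exists_ord4 (fun a => (a \in _) && (nth 0 [:: 0; p; q; r; N] a < y <
  nth 0 [:: 0; p; q; r; N] a.+1))) /= !inE.
lia.
Qed.

Section Mesh.

Variables (n : nat) (pi : 'S_n).
Implicit Types (t : 3.-tuple 'I_n) (m : 'I_n).

(** The shading is a product, so lying in some shaded box decouples into one condition on the
    position and one on the value. *)
Lemma forall_shading_product (A : seq nat) t :
  let x := nth 0 (position_lines t) in
  let y := nth 0 (value_lines pi t) in
  [forall c in [set c : 'I_4 * 'I_4 |
                 (nat_of_ord c.1 \in A) && (nat_of_ord c.2 \in A)],
      ~~ [exists m, in_box pi t c m]] =
  [forall m : 'I_n,
     ~~ ([exists a : 'I_4, ((a : nat) \in A) && (x a < m.+1 < x a.+1)] &&
         [exists b : 'I_4, ((b : nat) \in A) && (y b < (pi m).+1 < y b.+1)])].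
Proof.
move=> x y; apply/forall_inP/forallP => [noc m | nom c].
  apply/negP => /andP[/existsP[a /andP[aA xa]] /existsP[b /andP[bA yb]]].
  have /noc/existsPn/(_ m) : (a, b) \in [set c : 'I_4 * 'I_4 |
      (nat_of_ord c.1 \in A) && (nat_of_ord c.2 \in A)] by rewrite inE /= aA.
  by rewrite /in_box -/x -/y /= xa yb.
rewrite inE => /andP[c1A c2A]; apply/existsPn => m.
apply: contra (nom m) => /andP[xc yc].
by apply/andP; split; apply/existsP; [exists c.1 | exists c.2];
  rewrite ?c1A ?c2A.
Qed.

Let poss t := [seq (nat_of_ord i).+1 | i <- t].
Let vals t := sort leq [seq (nat_of_ord (pi i)).+1 | i <- t].

Let mem_poss t m : (m.+1 \in poss t) = (m \in t).
Proof. by rewrite (mem_map (f := fun i : 'I_n => i.+1)) // => i j [/val_inj]. Qed.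

Let mem_vals t m : ((pi m).+1 \in vals t) = (m \in t).
Proof.
rewrite mem_sort (mem_map (f := fun i : 'I_n => (pi i).+1)) //.
by move=> i j [/val_inj/perm_inj].
Qed.

Let sorted_poss t :
  sorted ltn [seq nat_of_ord i | i <- t] -> sorted leq (poss t).
Proof.
rewrite !sorted_map; apply: sub_sorted => i j /= /ltnW.
by rewrite /relpre /= ltnS.
Qed.

Let size_poss t : size (poss t) = 3.
Proof. by rewrite size_map size_tuple. Qed.

Let size_vals t : size (vals t) = 3.
Proof. by rewrite size_sort size_map size_tuple. Qed.

Let sorted_vals t : sorted leq (vals t).
Proof. exact/sort_sorted/leq_total. Qed.

(** The shaded region is everything left of some chosen point and below some chosen point, off the
    grid lines. As [pi] is injective, an entry is on a vertical grid line exactly when it is on a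
    horizontal one, namely when its index is in [t]. *)
Lemma is_occurrence_R1 tau t :
  is_occurrence pi (MeshPattern tau R1) t =
  [&& sorted ltn [seq nat_of_ord i | i <- t], order_isomorphic pi t tau
    & [forall m : 'I_n, (m \notin t) ==>
         ~~ (has (fun x : 'I_n => m < x) t && has (fun x => pi m < pi x) t)]].
Proof.
rewrite /is_occurrence /=; apply: andb_id2l => ts; congr (_ && _).
rewrite forall_shading_product; apply: eq_forallb => m.
rewrite /position_lines /value_lines -/(poss t) -/(vals t).
rewrite lower_strips ?sorted_poss // lower_strips //.
rewrite mem_poss mem_vals (eq_has_r (mem_sort _ _)) !has_map.
by case: (m \in t).
Qed.

Lemma is_occurrence_R2 tau t :
  is_occurrence pi (MeshPattern tau R2) t =
  [&& sorted ltn [seq nat_of_ord i | i <- t], order_isomorphic pi t tau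
    & [forall m : 'I_n, (m \notin t) ==>
         ~~ (has (fun x : 'I_n => x < m) t && has (fun x => pi x < pi m) t)]].
Proof.
rewrite /is_occurrence /=; apply: andb_id2l => ts; congr (_ && _).
rewrite forall_shading_product; apply: eq_forallb => m.
rewrite /position_lines /value_lines -/(poss t) -/(vals t).
rewrite upper_strips ?sorted_poss ?ltnS // upper_strips ?ltnS //.
rewrite mem_poss mem_vals (eq_has_r (mem_sort _ _)) !has_map.
by case: (m \in t).
Qed.

End Mesh.

(** * Half-turn symmetry exchanging the two shadings *)

Section ReverseComplement.

Variable n : nat.

Definition rev_perm : 'S_n := perm (@rev_ord_inj n).

Definition rev_compl (pi : 'S_n) : 'S_n := (rev_perm * pi * rev_perm)%g.

(** Complementing the indices makes them decrease; [rev] makes them increase again. *)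
Definition rev_compl_tuple k (t : k.-tuple 'I_n) : k.-tuple 'I_n :=
  [tuple of rev (map (@rev_ord n) t)].

Lemma rev_complE pi i : rev_compl pi i = rev_ord (pi (rev_ord i)).
Proof. by rewrite !permM !permE. Qed.

Lemma rev_complK : involutive rev_compl.
Proof. by move=> pi; apply/permP => i; rewrite !rev_complE !rev_ordK. Qed.

Lemma rev_compl_tupleK k : involutive (@rev_compl_tuple k).
Proof.
move=> t; apply/val_inj; rewrite /= map_rev revK.
exact/mapK/rev_ordK.
Qed.

Lemma tnth_rev_compl k (t : k.-tuple 'I_n) a :
  tnth (rev_compl_tuple t) a = rev_ord (tnth t (rev_ord a)).
Proof.
(* An element of ['I_n], serving as the default of [nth]. *)
have x := tnth t a.
rewrite (tnth_nth x) (tnth_nth x) /= nth_rev size_map size_tuple //.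
by rewrite (nth_map x) // size_tuple; case: a => /= a; lia.
Qed.

Lemma ltn_rev_ord k (i j : 'I_k) : (rev_ord i < rev_ord j) = (j < i).
Proof. by rewrite /=; case: i j => [i ?] [j ?] /=; lia. Qed.

Lemma order_isomorphic_rev_compl k (pi : 'S_n) t (tau : 'S_k) :
  (forall a, tau (rev_ord a) = rev_ord (tau a)) ->
  order_isomorphic (rev_compl pi) (rev_compl_tuple t) tau =
  order_isomorphic pi t tau.
Proof.
move=> tau_rev; apply/'forall_forallP/'forall_forallP => h a b; apply/eqP;
  have /eqP := h (rev_ord b) (rev_ord a).
  by rewrite !rev_complE !tnth_rev_compl !tau_rev !rev_ordK !ltn_rev_ord.
by rewrite !rev_complE !tnth_rev_compl !tau_rev !rev_ordK !ltn_rev_ord.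
Qed.

(** A half turn of the plot sends box (a,b) to (3-a,3-b), hence [R1] to [R2]; the hypothesis says
    that [tau] itself is fixed by the half turn. *)
Lemma is_occurrence_rev_compl (pi : 'S_n) t (tau : 'S_3) :
  (forall a, tau (rev_ord a) = rev_ord (tau a)) ->
  is_occurrence (rev_compl pi) (MeshPattern tau R2) (rev_compl_tuple t) =
  is_occurrence pi (MeshPattern tau R1) t.
Proof.
move=> tau_rev.
rewrite is_occurrence_R1 is_occurrence_R2 order_isomorphic_rev_compl //.
congr [&& _, _ & _].
  rewrite map_rev rev_sorted !sorted_map; apply: eq_sorted => i j /=.
  exact: ltn_rev_ord.
have P (m : 'I_n) : (rev_ord m \notin rev_compl_tuple t) = (m \notin t).
  by rewrite mem_rev mem_map //; apply: rev_ord_inj.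
have Q (m : 'I_n) : has (fun x : 'I_n => x < rev_ord m) (rev_compl_tuple t) =
    has (fun x : 'I_n => m < x) t.
  by rewrite has_rev has_map; apply: eq_has => x; apply: ltn_rev_ord.
have S (m : 'I_n) :
    has (fun x => rev_compl pi x < rev_compl pi (rev_ord m)) (rev_compl_tuple t) =
    has (fun x => pi m < pi x) t.
  rewrite has_rev has_map; apply: eq_has => x /=.
  by rewrite !rev_complE !rev_ordK ltn_rev_ord.
apply/forallP/forallP => h m.
  by rewrite -P -Q -S.
by rewrite -(rev_ordK m) P Q S.
Qed.

Lemma occurrences_rev_compl (pi : 'S_n) (tau : 'S_3) :
  (forall a, tau (rev_ord a) = rev_ord (tau a)) ->
  occurrences (rev_compl pi) (MeshPattern tau R2) =
  occurrences pi (MeshPattern tau R1).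
Proof.
move=> tau_rev; rewrite /occurrences.
have tK := can_inj (@rev_compl_tupleK 3).
rewrite -(card_imset _ tK); apply: eq_card => t.
by rewrite -[t]rev_compl_tupleK mem_imset // !inE !rev_compl_tupleK
  -is_occurrence_rev_compl // rev_compl_tupleK.
Qed.

End ReverseComplement.

Lemma jointly_equidistributed_rev_compl (tau1 tau2 : 'S_3) :
  (forall a, tau1 (rev_ord a) = rev_ord (tau1 a)) ->
  (forall a, tau2 (rev_ord a) = rev_ord (tau2 a)) ->
  jointly_equidistributed (MeshPattern tau1 R1) (MeshPattern tau2 R1) ->
  jointly_equidistributed (MeshPattern tau1 R2) (MeshPattern tau2 R2).
Proof.
move=> h1 h2 eq1 n k l n_gt0.
have tr k' l' : #|[set pi : 'S_n | (occurrences pi (MeshPattern tau1 R2) == k') &&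
      (occurrences pi (MeshPattern tau2 R2) == l')]| =
    #|[set pi : 'S_n | (occurrences pi (MeshPattern tau1 R1) == k') &&
      (occurrences pi (MeshPattern tau2 R1) == l')]|.
  rewrite -(card_imset _ (can_inj (@rev_complK n))).
  apply: eq_card => pi; rewrite -(rev_complK pi) mem_imset ?inE;
    last exact: can_inj (@rev_complK n).
  by rewrite !rev_complK -!occurrences_rev_compl // rev_complK.
by rewrite !tr; apply: eq1.
Qed.

(** * Occurrences of the two patterns, letter by letter *)

Lemma forall_ord3 (P : pred 'I_3) :
  [forall a, P a] = [&& P (@Ordinal 3 0 isT), P (@Ordinal 3 1 isT)
                      & P (@Ordinal 3 2 isT)].
Proof.
apply/forallP/and3P => [h | [h0 h1 h2] [[|[|[|//]]] p]]; first by split.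
- by rewrite (_ : Ordinal p = Ordinal (isT : 0 < 3)) //; apply/val_inj.
- by rewrite (_ : Ordinal p = Ordinal (isT : 1 < 3)) //; apply/val_inj.
- by rewrite (_ : Ordinal p = Ordinal (isT : 2 < 3)) //; apply/val_inj.
Qed.

Lemma tuple3P T (t : 3.-tuple T) : exists i j l, t = [tuple i; j; l].
Proof.
by case: t => [[|i [|j [|l []]]]] // p; exists i, j, l; apply: val_inj.
Qed.

Section ThreeLetters.

Variables (n : nat) (pi : 'S_n) (i j l : 'I_n).

Lemma order_isomorphic_123 :
  order_isomorphic pi [tuple i; j; l] perm123 = (pi i < pi j < pi l).
Proof.
by rewrite /order_isomorphic !forall_ord3 !perm1 !(tnth_nth i) /=; lia.
Qed.

Lemma order_isomorphic_321 :
  order_isomorphic pi [tuple i; j; l] perm321 = (pi l < pi j < pi i).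
Proof.
by rewrite /order_isomorphic !forall_ord3 !permE !(tnth_nth i) /=; lia.
Qed.

(** In 123 the last letter is also the largest, so the region to keep empty is all that lies left of
    and below it, apart from the other two letters. *)
Lemma is_occurrence_123P :
  reflect [/\ i < j < l, pi i < pi j < pi l &
            forall m : 'I_n, m < l -> pi m < pi l -> (m == i) || (m == j)]
    (is_occurrence pi (MeshPattern perm123 R1) [tuple i; j; l]).
Proof.
rewrite is_occurrence_R1 order_isomorphic_123 /= andbT.
apply: (iffP and3P) => -[ijl pijl h]; split=> //; last apply/forallP => m.
  move=> m ml pml; move/forallP/(_ m): h; rewrite !inE ml pml !orbT implybF negbK.
  by case/or3P => [->|->|/eqP ml']; rewrite ?orbT //; move: ml; rewrite ml' ltnn.
apply/implyP; rewrite !inE => /norP[mi /norP[mj ml]].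
apply/negP => /= /andP[m_lt pm_lt].
have {}m_lt : m < l by lia.
have {}pm_lt : pi m < pi l by lia.
by have := h m m_lt pm_lt; rewrite (negbTE mi) (negbTE mj).
Qed.

(** In 321 the region is bounded on the right by the last letter and above by the first, so only the
    middle letter lies inside it. *)
Lemma is_occurrence_321P :
  reflect [/\ i < j < l, pi l < pi j < pi i &
            forall m : 'I_n, m < l -> pi m < pi i -> m == j]
    (is_occurrence pi (MeshPattern perm321 R1) [tuple i; j; l]).
Proof.
rewrite is_occurrence_R1 order_isomorphic_321 /= andbT.
apply: (iffP and3P) => -[ijl pijl h]; split=> //; last apply/forallP => m.
  move=> m ml pml; move/forallP/(_ m): h; rewrite !inE ml pml !orbT implybF negbK.
  by case/or3P => [/eqP mi|->|/eqP ml'] //;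
    [move: pml; rewrite mi ltnn | move: ml; rewrite ml' ltnn].
apply/implyP; rewrite !inE => /norP[mi /norP[mj ml]].
apply/negP => /= /andP[m_lt pm_lt].
have {}m_lt : m < l by lia.
have {}pm_lt : pi m < pi i by lia.
by have := h m m_lt pm_lt; rewrite (negbTE mj).
Qed.

End ThreeLetters.

(** * Appending a last entry of given rank *)

Section AppendLast.

Variable n : nat.
Implicit Types (r : 'I_n.+1) (s : 'S_n).

(** The last position gets value [r]; the values of [s] that are at least [r] move up by one. *)
Definition append r s : 'S_n.+1 := lift_perm ord_max r s.

Lemma append_bij : bijective (fun x : 'I_n.+1 * 'S_n => append x.1 x.2).
Proof.
apply: inj_card_bij; last by rewrite card_prod !card_Sn card_ord factS.
move=> [r s] [r' s'] /permP /= eq_rs.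
have := eq_rs ord_max; rewrite !lift_perm_id => eq_r; congr (_, _) => //.
apply/permP => i; have := eq_rs (lift ord_max i).
by rewrite !lift_perm_lift eq_r => /lift_inj.
Qed.

Lemma ltn_lift (h : 'I_n.+1) (i j : 'I_n) : (lift h i < lift h j) = (i < j).
Proof. by rewrite /= /bump; lia. Qed.

Lemma order_isomorphic_append k r s (t : k.-tuple 'I_n) tau :
  order_isomorphic (append r s) (map_tuple (lift ord_max) t) tau =
  order_isomorphic s t tau.
Proof.
apply: eq_forallb => a; apply: eq_forallb => b.
by rewrite !tnth_map !lift_perm_lift ltn_lift.
Qed.

(** Lifting preserves the order of positions and values, and the new entry, right of all chosen
    ones, cannot lie in the region shaded by [R1]. *)
Lemma is_occurrence_append r s tau (t : 3.-tuple 'I_n) :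
  is_occurrence (append r s) (MeshPattern tau R1) (map_tuple (lift ord_max) t) =
  is_occurrence s (MeshPattern tau R1) t.
Proof.
rewrite !is_occurrence_R1 order_isomorphic_append; congr [&& _, _ & _].
  by rewrite -map_comp; congr sorted; apply: eq_map => i; apply: lift_max.
have P m : (lift ord_max m \in map_tuple (lift ord_max) t) = (m \in t).
  by rewrite mem_map //; apply: lift_inj.
have Q (m : 'I_n) : has (fun x : 'I_n.+1 => lift ord_max m < x)
    (map_tuple (lift ord_max) t) = has (fun x : 'I_n => m < x) t.
  by rewrite has_map; apply: eq_has => x; apply: ltn_lift.
have S m : has (fun x => append r s (lift ord_max m) < append r s x)
    (map_tuple (lift ord_max) t) = has (fun x => s m < s x) t.
  by rewrite has_map; apply: eq_has => x /=; rewrite !lift_perm_lift ltn_lift.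
apply/forallP/forallP => h m; first by rewrite -P -Q -S.
case: (unliftP ord_max m) => [m' ->|->]; first by rewrite P Q S.
apply/implyP => _; rewrite negb_and; apply/orP; left.
by apply/hasPn => x _ /=; rewrite -leqNgt leq_ord.
Qed.

(** Occurrences are split by whether they use the new entry; those that do not are the lifts of the
    old ones. *)
Lemma occurrences_append r s tau :
  occurrences (append r s) (MeshPattern tau R1) =
  occurrences s (MeshPattern tau R1) +
  #|[set t | is_occurrence (append r s) (MeshPattern tau R1) t &
             tnth t ord_max == ord_max]|.
Proof.
have lift_inj3 : injective (map_tuple (lift (@ord_max n)) : 3.-tuple _ -> _).
  by move=> t t' /(congr1 val)/(inj_map (@lift_inj _ _))/val_inj.
rewrite /occurrences -(card_imset _ lift_inj3).
rewrite -[LHS](cardsID [set t | tnth t ord_max == ord_max]) addnC.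
congr (_ + _); apply: eq_card => t; last by rewrite !inE.
rewrite !inE; apply/andP/imsetP => [[t_max t_occ] | [t' t'_occ ->]].
  have /and3P[] := t_occ; have [i [j [l t_ijl]]] := tuple3P t.
  move: t_occ t_max; rewrite t_ijl (tnth_nth i) /= => t_occ l_max.
  rewrite andbT => /andP[ij jl] _ _.
  (* The indices increase and [l] is not the last position, so all three are lifts. *)
  have [l' l_l' | l_eq] := unliftP ord_max l; last by rewrite l_eq eqxx in l_max.
  have [j' j_j' | j_eq] := unliftP ord_max j; last first.
    by move: jl (ltn_ord l); rewrite j_eq /=; lia.
  have [i' i_i' | i_eq] := unliftP ord_max i; last first.
    by move: ij (ltn_ord j); rewrite i_eq /=; lia.
  exists [tuple i'; j'; l']; last by apply: val_inj; rewrite /= i_i' j_j' l_l'.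
  rewrite inE -(is_occurrence_append r) (_ : map_tuple _ _ = [tuple i; j; l]) //.
  by apply: val_inj; rewrite /= i_i' j_j' l_l'.
rewrite is_occurrence_append; rewrite inE in t'_occ; split=> //.
by rewrite tnth_map eq_sym neq_lift.
Qed.

End AppendLast.

(** * The two-state rule for the new entry *)

Definition ascending n (s : 'S_n.+2) :=
  (s^-1)%g ord0 < (s^-1)%g (Ordinal (isT : 1 < n.+2)).

Section LastEntry.

Variable n : nat.
Implicit Types (r : 'I_n.+3) (s : 'S_n.+2).

Let one : 'I_n.+2 := Ordinal (isT : 1 < n.+2).

(** A new entry of rank 0 or 1 becomes one of the two smallest and stands last; a higher rank leaves
    those two in place. *)
Lemma ascending_append r s :
  ascending (append r s) = (r == 1 :> nat) || (1 < r) && ascending s.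
Proof.
rewrite /ascending lift_permV.
set o1 := Ordinal _.
case: (unliftP r ord0) => [k0 e0|e0]; case: (unliftP r o1) => [k1 e1|e1].
- have k0E : k0 = ord0.
    by apply/val_inj; move/(congr1 val): e0; rewrite /= /bump; lia.
  have r_gt1 : 1 < r.
    by move/(congr1 val): e0; move/(congr1 val): e1; rewrite /= /bump; lia.
  have k1E : k1 = one.
    by apply/val_inj; move/(congr1 val): e1; rewrite /= /bump; lia.
  by rewrite e0 e1 !lift_perm_lift ltn_lift k0E k1E r_gt1 gtn_eqF.
- have r1 : r = 1 :> nat by rewrite -e1.
  by rewrite r1 e0 e1 lift_perm_lift lift_perm_id lift_max ltn_ord.
- have r0 : r = 0 :> nat by rewrite -e0.
  rewrite r0 /= e0 lift_perm_id; apply/negbTE; rewrite -leqNgt.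
  exact: leq_ord.
- by move: e0; rewrite -e1.
Qed.

Let appendE r s (i : 'I_n.+2) :
  append r s (lift ord_max i) = bump r (s i) :> nat.
Proof. by rewrite lift_perm_lift. Qed.

Let value_at s (k : nat) (k_lt : k < n.+2) :
  s ((s^-1)%g (Ordinal k_lt)) = k :> nat.
Proof. by rewrite permKV. Qed.

(** The values below the new entry are exactly the other two letters, which forces [r] to be 2 and
    leaves [t0] as the sole candidate. *)
Lemma last_occurrence_123 r s :
  #|[set t | is_occurrence (append r s) (MeshPattern perm123 R1) t &
             tnth t ord_max == ord_max]| = ((r == 2 :> nat) && ascending s).
Proof.
set S := [set t | _].
pose t0 : 3.-tuple 'I_n.+3 :=
  [tuple lift ord_max ((s^-1)%g ord0); lift ord_max ((s^-1)%g one); ord_max].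
have memS t : t \in S -> [/\ r = 2 :> nat, ascending s & t = t0].
  have [i [j [l ->]]] := tuple3P t; rewrite inE (tnth_nth i) /=.
  case/andP => + /eqP l_max; rewrite {l}l_max.
  case/is_occurrence_123P => ijl pijl h.
  have [j' j_j' | j_eq] := unliftP ord_max j; last by rewrite j_eq in ijl; lia.
  have [i' i_i' | i_eq] := unliftP ord_max i; last by rewrite i_eq in ijl; lia.
  subst i j; rewrite !appendE lift_perm_id !lift_max in pijl ijl.
  (* The emptiness condition, applied to the position where [s] takes the value [k]. *)
  have hv (k : 'I_n.+2) : k < r -> (k == s i' :> nat) || (k == s j' :> nat).
    move=> k_lt; have := h (lift ord_max ((s^-1)%g k)).
    rewrite lift_max ltn_ord appendE permKV lift_perm_id !(inj_eq lift_inj).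
    rewrite !(can2_eq (permKV s) (permK s)); apply=> //.
    by rewrite /bump; lia.
  have si : s i' = 0 :> nat by have := hv ord0; move: pijl; rewrite /bump /=; lia.
  have sj : s j' = 1 :> nat by have := hv one; move: pijl; rewrite /bump /=; lia.
  have r2 : r = 2 :> nat.
    have [|r_gt2] := leqP r 2; first by move: pijl; rewrite /bump; lia.
    (* For [r] above 2, the value 2 of [s] would be a third entry below the new one. *)
    have n_gt2 : 2 < n.+2 by have := ltn_ord r; lia.
    by have := hv (Ordinal n_gt2) r_gt2; rewrite /= si sj.
  have i'E : i' = (s^-1)%g ord0.
    by apply: (@perm_inj _ s); rewrite permKV; apply: val_inj.
  have j'E : j' = (s^-1)%g one.
    by apply: (@perm_inj _ s); rewrite permKV; apply: val_inj.
  split=> //; last by rewrite /t0 -i'E -j'E.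
  by rewrite /ascending -/one -i'E -j'E; lia.
have [/andP[/eqP r2 asc_s] | no] := boolP (_ && _); last first.
  apply/eqP; rewrite cards_eq0 -subset0; apply/subsetP => t /memS[r2 asc_s _].
  by rewrite r2 eqxx asc_s in no.
suff -> : S = [set t0] by rewrite cards1.
apply/setP => t; rewrite inE; apply/idP/eqP => [/memS[] // | ->].
rewrite inE (tnth_nth ord_max) /= eqxx andbT.
apply/is_occurrence_123P; rewrite !appendE lift_perm_id !lift_max !value_at r2.
split=> [||m].
- by rewrite ltn_ord andbT.
- by rewrite /bump /=; lia.
have [m' -> _ | ->] := unliftP ord_max m; last by rewrite ltnn.
rewrite appendE !(inj_eq lift_inj) r2 -!(can2_eq (permK s) (permKV s)).
by rewrite -!val_eqE /= /bump; lia.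
Qed.

(** Only the middle letter lies left of the new entry and below the first letter. So the middle
    letter has value 0 in [s], the new entry goes below it, and the first letter has value 1 in
    [s]. *)
Lemma last_occurrence_321 r s :
  #|[set t | is_occurrence (append r s) (MeshPattern perm321 R1) t &
             tnth t ord_max == ord_max]| = ((r == 0 :> nat) && ~~ ascending s).
Proof.
set S := [set t | _].
pose t0 : 3.-tuple 'I_n.+3 :=
  [tuple lift ord_max ((s^-1)%g one); lift ord_max ((s^-1)%g ord0); ord_max].
have memS t : t \in S -> [/\ r = 0 :> nat, ~~ ascending s & t = t0].
  have [i [j [l ->]]] := tuple3P t; rewrite inE (tnth_nth i) /=.
  case/andP => + /eqP l_max; rewrite {l}l_max.
  case/is_occurrence_321P => ijl pijl h.
  have [j' j_j' | j_eq] := unliftP ord_max j; last by rewrite j_eq in ijl; lia.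
  have [i' i_i' | i_eq] := unliftP ord_max i; last by rewrite i_eq in ijl; lia.
  subst i j; rewrite !appendE lift_perm_id !lift_max in pijl ijl.
  have hv (k : 'I_n.+2) : bump r k < bump r (s i') -> k = s j' :> nat.
    move=> k_lt; have := h (lift ord_max ((s^-1)%g k)).
    rewrite lift_max ltn_ord !appendE permKV !(inj_eq lift_inj).
    by rewrite !(can2_eq (permKV s) (permK s)) => /(_ isT k_lt)/eqP->.
  have sj : s j' = 0 :> nat by have := hv ord0; move: pijl; rewrite /bump /=; lia.
  have r0 : r = 0 :> nat by move: pijl; rewrite sj /bump; lia.
  have si : s i' = 1 :> nat by have := hv one; move: pijl; rewrite /bump /=; lia.
  have i'E : i' = (s^-1)%g one.
    by apply: (@perm_inj _ s); rewrite permKV; apply: val_inj.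
  have j'E : j' = (s^-1)%g ord0.
    by apply: (@perm_inj _ s); rewrite permKV; apply: val_inj.
  split=> //; last by rewrite /t0 -i'E -j'E.
  by rewrite /ascending -/one -i'E -j'E; lia.
have [/andP[/eqP r0 desc_s] | no] := boolP (_ && _); last first.
  apply/eqP; rewrite cards_eq0 -subset0; apply/subsetP => t /memS[r0 desc_s _].
  by rewrite r0 eqxx desc_s in no.
suff -> : S = [set t0] by rewrite cards1.
apply/setP => t; rewrite inE; apply/idP/eqP => [/memS[] // | ->].
rewrite inE (tnth_nth ord_max) /= eqxx andbT.
apply/is_occurrence_321P; rewrite !appendE lift_perm_id !lift_max !value_at r0.
split=> [||m].
- rewrite ltn_ord andbT ltn_neqAle leqNgt desc_s andbT.
  by rewrite (inj_eq val_inj) (inj_eq perm_inj).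
- by rewrite /bump /=; lia.
have [m' -> _ | ->] := unliftP ord_max m; last by rewrite ltnn.
rewrite appendE !(inj_eq lift_inj) r0 -!(can2_eq (permK s) (permKV s)).
by rewrite -!val_eqE /= /bump; lia.
Qed.

End LastEntry.

(** * The injection exchanging the two patterns *)

Lemma occurrences_small n (pi : 'S_n) (q : mesh_pattern 3) :
  n < 3 -> occurrences pi q = 0.
Proof.
move=> n_lt3; apply/eqP; rewrite cards_eq0 -subset0; apply/subsetP => t.
have [i [j [l ->]]] := tuple3P t; rewrite inE => /and3P[+ _ _].
by rewrite /= andbT; have := ltn_ord l; lia.
Qed.

Section Swap.

Variable n : nat.
Implicit Types (r : 'I_n.+3) (s : 'S_n.+2).

Let rank (k : nat) (k_lt : k < 3) : 'I_n.+3 :=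
  Ordinal (leq_trans k_lt (isT : 3 <= n.+3)).

Definition cycle012 : 'S_n.+3 :=
  (tperm ord0 (rank (isT : 1 < 3)) * tperm ord0 (rank (isT : 2 < 3)))%g.

Lemma cycle012E r :
  cycle012 r = (if r < 2 then r.+1 else if r == 2 :> nat then 0 else r) :> nat.
Proof.
rewrite permM; case: (tpermP ord0 _ r) => [->|->|/eqP r0 /eqP r1].
- by rewrite tpermD.
- by rewrite tpermL.
case: tpermP => [r_eq|->//|_ /eqP r2]; first by rewrite r_eq eqxx in r0.
by move: r0 r1 r2; rewrite -!val_eqE /=; case: (nat_of_ord r) => [|[|[|k]]].
Qed.

Lemma cycle012VE r :
  (cycle012^-1)%g r =
  (if r == 0 :> nat then 2 else if r <= 2 then r.-1 else r) :> nat.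
Proof.
(* Writing [r] as the image of its preimage reduces the claim to the formula for [cycle012]. *)
rewrite -{2 3 4 5}(permKV cycle012 r) cycle012E.
by case: ((cycle012^-1)%g r) => k k_lt /=; case: k k_lt => [|[|[|k]]].
Qed.

Definition swap_rank (asc : bool) : 'S_n.+3 :=
  if asc then cycle012 else (cycle012^-1)%g.

End Swap.

(** The reversal of the state is part of the induction: it determines which rank the next entry must
    receive. *)
Lemma exists_swap n : exists2 f : 'S_n.+2 -> 'S_n.+2, injective f &
  forall s, [/\ ascending (f s) = ~~ ascending s,
    occurrences (f s) (MeshPattern perm123 R1) =
    occurrences s (MeshPattern perm321 R1) &
    occurrences (f s) (MeshPattern perm321 R1) =
    occurrences s (MeshPattern perm123 R1)].
Proof.
elim: n => [|n [f f_inj fP]].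
  (* In length two, exchanging the two values flips the state, and no pattern of length three
     occurs. *)
  exists (fun s => s * tperm ord0 (Ordinal (isT : 1 < 2)))%g; first exact: mulIg.
  move=> s; rewrite !occurrences_small //; split=> //.
  rewrite /ascending invMg tpermV !permM tpermL tpermR ltnNge leq_eqVlt.
  by rewrite (inj_eq val_inj) (inj_eq perm_inj).
have [split_last splitK appendK] := append_bij n.+2.
pose g (x : 'I_n.+3 * 'S_n.+2) := append (swap_rank n (ascending x.2) x.1) (f x.2).
exists (g \o split_last).
  apply: inj_comp; last exact: can_inj appendK.
  have append_inj := bij_inj (append_bij n.+2).
  (* The prefix is recovered first; its state then tells which permutation of ranks to undo. *)
  move=> [r s] [r' s'] /(append_inj (_, _) (_, _)) [/[swap] /f_inj <-].
  by move=> /perm_inj ->.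
move=> pi; rewrite -(appendK pi) /= splitK; case: (split_last pi) => r s.
have [f_asc f123 f321] := fP s.
rewrite /g /= !ascending_append !occurrences_append.
rewrite !last_occurrence_123 !last_occurrence_321 f_asc f123 f321 /swap_rank.
(* Ranks 0, 1, 2 from the ascending state match ranks 1, 2, 0 from the descending one, with opposite
   new states; a 123 from rank 2 matches a 321 from rank 0. *)
by case: (ascending s); rewrite ?cycle012E ?cycle012VE /=;
  case: (nat_of_ord r) => [|[|[|k]]].
Qed.

(** * Joint equidistribution for both shadings *)

Lemma jointly_equidistributed_R1 :
  jointly_equidistributed (MeshPattern perm123 R1) (MeshPattern perm321 R1).
Proof.
case=> [|[|n]] k l // _.
  by apply: eq_card => pi; rewrite !inE !occurrences_small // andbC.
have [f f_inj fP] := exists_swap n.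
pose A k l := [set pi : 'S_n.+2 |
  (occurrences pi (MeshPattern perm123 R1) == k) &&
  (occurrences pi (MeshPattern perm321 R1) == l)].
(* The injection gives one inequality for every pair; exchanging the pair gives the other. *)
suff le k' l' : #|A k' l'| <= #|A l' k'|.
  by apply/eqP; rewrite eqn_leq !le.
rewrite -(card_imset _ f_inj); apply/subset_leq_card/subsetP => _ /imsetP[pi + ->].
by have [_ f123 f321] := fP pi; rewrite !inE f123 f321 andbC.
Qed.

Theorem theorem2p1 :
  jointly_equidistributed (MeshPattern perm123 R1) (MeshPattern perm321 R1) /\
  jointly_equidistributed (MeshPattern perm123 R2) (MeshPattern perm321 R2).
Proof.
split; first exact: jointly_equidistributed_R1.
apply: jointly_equidistributed_rev_compl jointly_equidistributed_R1 => a.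
  by rewrite !perm1.
by rewrite !permE.
Qed.
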